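(* Let $P \in \mathbb{C}[X]$ be a polynomial of degree $d$ with exactly $r \ge 2$ distinct complex roots, and let $V = \{v_1, \dots, v_r\} \subset \mathbb{C}$ be the set of its distinct roots. For a root $v$ of $P$, let $\mathrm{sep}(P, v) = \min\{|v - w| : w \in V,\ w \ne v\}$. Then for every subset $V' \subset V$, $$ \prod_{v \in V'}\mathrm{sep}(P, v) \ \ge\ |\mathrm{sDisc}_{d-r}(P)| \, \mathrm{M}(P)^{-2(r-1)} \Big(\frac{r}{\sqrt{3}}\Big)^{-\#V'} \,r^{-r} \, \Big(\frac13\Big)^{\min \{d,\, 2d-2r\}/3}. $$
   Context: Write $P = a_d \prod_{j=1}^r (X - v_j)^{m_j}$ with $a_d \ne 0$, $v_1,\dots,v_r$ pairwise distinct, $m_j \in \mathbb{N}$, $\sum_j m_j = d$; let $x_1,\dots,x_d$ be the roots of $P$ listed with multiplicity. The Mahler measure is $\mathrm{M}(P) = |a_d| \prod_{i=1}^d \max\{1,|x_i|\}$. For $0 \le k < d$, the $k$-th subdiscriminant is $\mathrm{sDisc}_k(P) = a_d^{2(d-k)-2} \sum_{I \subset \{1,\dots,d\},\ |I| = d-k} \ \prod_{i,j \in I,\ i<j} (x_i - x_j)^2$. In particular $|\mathrm{sDisc}_{d-r}(P)|^{1/2} = |a_d|^{r-1} \big(\prod_{j=1}^r m_j\big)^{1/2} \prod_{1\le i<j\le r}|v_i - v_j|$. *)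

(* Defs.v *)
(* The complex field C is modelled by an arbitrary
   numClosedFieldType (algebraically closed field with conjugation and norm,
   e.g. the complex numbers); norms `|x| live in C and are real. *)
From HB Require Import structures.
From mathcomp Require Import all_boot all_order all_algebra all_field.
Set Implicit Arguments. Unset Strict Implicit. Unset Printing Implicit Defensive.
Import Order.TTheory GRing.Theory Num.Theory.
Local Open Scope ring_scope.

(* In all definitions, [xs] is the list of roots of [p] listed with
   multiplicity, i.e. p = lead_coef p *: \prod_(x <- xs) ('X - x%:P). *)

Definition mahler (C : numClosedFieldType) (p : {poly C}) (xs : seq C) : C :=
  `|lead_coef p| * \prod_(x <- xs) Num.max 1 `|x|.

Definition sDisc (C : numClosedFieldType) (p : {poly C}) (xs : seq C) (k : nat) : C :=
  let d := (size p).-1 in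
  lead_coef p ^+ (2 * (d - k) - 2) *
  \sum_(I : {set 'I_(size xs)} | #|I| == (d - k)%N)
     \prod_(i in I) \prod_(j in I | (i < j)%N) (xs`_i - xs`_j) ^+ 2.

Definition sep (C : numClosedFieldType) (xs : seq C) (v : C) : C :=
  let ds := [seq `|v - w| | w <- undup xs & w != v] in
  foldr Num.min (head 0 ds) ds.

(* Main.v *)
(* Order the distinct roots v_1, ..., v_r by increasing modulus.  For a simple
   graph whose edges go from smaller to larger indices, replacing the rows of
   the Vandermonde matrix by divided differences at v_j and its neighbours and
   applying Hadamard's inequality bounds prod_(i<j) |v_i - v_j| by the product of
   the edge lengths, up to the factor prod_j max(1, |v_j|)^(r-1), a power of r
   and one factor r / sqrt 3 per edge.  The edges joining each v in V' to a
   nearest other root split into two such graphs, according to whether the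
   nearest root comes before or after v; the product of the two bounds is the
   claim, because |sDisc_(d-r)| is
   |a_d|^(2r-2) (prod_j m_j) prod_(i<j) |v_i - v_j|^2 and the product of the
   multiplicities is controlled by m^3 <= 3^m and m^3 <= 3^(2(m-1)). *)
Require Import Defs.
From HB Require Import structures.
From mathcomp Require Import all_boot all_order all_algebra all_field.
From mathcomp Require Import ring zify.
Import Order.TTheory GRing.Theory Num.Theory.
Set Implicit Arguments. Unset Strict Implicit. Unset Printing Implicit Defensive.
Local Open Scope ring_scope.
Local Open Scope sesquilinear_scope.

(** * Hadamard's determinant inequality *)

Lemma gram_diag (C : numClosedFieldType) m n (A : 'M[C]_(m, n)) i :
  (A *m A ^t*) i i = \sum_j `|A i j| ^+ 2.
Proof. by rewrite mxE; apply: eq_bigr => j _; rewrite !mxE normCK. Qed.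

(** Gram-Schmidt gives [A = L *m S] with [S] unitary and [L] lower triangular. Hence [\det A] has
    the modulus of the diagonal product of [L], and each row of [L] has the norm of the same row of
    [A]. *)
Lemma hadamard (C : numClosedFieldType) n (A : 'M[C]_n) :
  `|\det A| ^+ 2 <= \prod_i \sum_j `|A i j| ^+ 2.
Proof.
pose S := schmidt A; have SU : S \is unitarymx by apply: schmidt_unitarymx.
pose L := A *m S ^t*; have AE : A = L *m S by rewrite /L mulmxKtV.
have SS : S *m S ^t* = 1%:M by apply/unitarymxP.
have detS : `|\det S| ^+ 2 = 1.
  by rewrite normCK -det_map_mx -[X in _ * X]det_tr map_trmx -det_mulmx SS det1.
have Ltrig : is_trig_mx L.
  apply/is_trig_mxP => i j ltij.
  (* Row [i] of [A] lies in the span of the rows [k <= i] of [S], all orthogonal to row [j]. *)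
  have /sub_kermxP/matrixP/(_ 0 0) : (row i A <= kermx (col j (S ^t*)))%MS.
    apply: submx_trans (row_schmidt_sub A i) _; apply/sumsmx_subP => k leki.
    rewrite genmxE; apply/sub_kermxP/matrixP => a b.
    rewrite colE mulmxA -row_mul -colE -/S SS !mxE; case: eqP => // jk.
    by move: leki; rewrite jk leqNgt ltij.
  by rewrite colE mulmxA -row_mul -colE !mxE.
rewrite {1}AE det_mulmx normrM exprMn detS mulr1 det_trig // normr_prod -prodrXl.
apply: ler_prod => i _; rewrite exprn_ge0 //= -gram_diag.
have -> : A *m A ^t* = L *m L ^t*.
  rewrite {1 2}AE trmx_mul map_mxM /= -mulmxA (mulmxA S) SS mul1mx //.
rewrite gram_diag (bigD1 i) //= lerDl sumr_ge0 // => j _.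
by rewrite exprn_ge0.
Qed.

(** * Divided differences of monomials *)

(* The divided difference of the function x |-> x^k at the nodes [us]; the
   successor case is the Leibniz rule for the product of x and x^k. *)
Fixpoint divdiff (R : pzRingType) (us : seq R) (k : nat) : R :=
  if us is u :: vs then
    if k is k'.+1 then u * divdiff us k' + divdiff vs k' else (vs == [::])%:R
  else 0.

Lemma divdiffS (R : pzRingType) (u : R) us k :
  divdiff (u :: us) k.+1 = u * divdiff (u :: us) k + divdiff us k.
Proof. by []. Qed.

Lemma divdiff0 (R : pzRingType) k : divdiff [::] k = 0 :> R.
Proof. by case: k. Qed.

Lemma divdiff1 (R : pzRingType) (u : R) k : divdiff [:: u] k = u ^+ k.
Proof. by elim: k => // k IH; rewrite divdiffS IH divdiff0 addr0 exprS. Qed.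

(** The usual quotient recursion with its denominator cleared, so that it also holds for [y = u] and
    over any commutative ring. *)
Lemma divdiff_rec (R : comPzRingType) (y u : R) us k :
  (y - u) * divdiff [:: y, u & us] k = divdiff (y :: us) k - divdiff (u :: us) k.
Proof.
elim: k us => [|k IH] us; first by rewrite /= mulr0 subrr.
have -> : (y - u) * divdiff [:: y, u & us] k.+1 =
    y * ((y - u) * divdiff [:: y, u & us] k) + (y - u) * divdiff (u :: us) k.
  by rewrite divdiffS; ring.
by rewrite IH !divdiffS; ring.
Qed.

(** Lagrange form of the divided difference. The weights do not depend on [k], so a row of divided
    differences is a combination of Vandermonde rows. *)
Lemma divdiff_interp (F : fieldType) (us : seq F) (y : F) :
  uniq (y :: us) ->
  exists c : F -> F, forall k,
    divdiff (y :: us) k = (\prod_(u <- us) (y - u))^-1 * y ^+ k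
                     + \sum_(u <- us) c u * u ^+ k.
Proof.
elim: us y => [|u us IH] y.
  by exists (fun=> 0) => k; rewrite divdiff1 !big_nil invr1 mul1r addr0.
rewrite /= inE negb_or => /and3P[/andP[nyu nyus] nuus Uus].
have [|c cE] := IH y; first by rewrite /= nyus.
have [|b bE] := IH u; first by rewrite /= nuus.
have nz : y - u != 0 by rewrite subr_eq0.
(* By [divdiff_rec] the weights are those at [y :: us] minus those at [u :: us], over [y - u]; the
   node [u] occurs only in the second list, as its head. *)
exists (fun z => (y - u)^-1 *
  if z == u then - (\prod_(w <- us) (u - w))^-1 else c z - b z) => k.
apply: (mulfI nz); rewrite divdiff_rec cE bE !big_cons eqxx.
have -> : \sum_(j <- us) (y - u)^-1 *
    (if j == u then - (\prod_(w <- us) (u - w))^-1 else c j - b j) * j ^+ k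
  = (y - u)^-1 * (\sum_(j <- us) c j * j ^+ k - \sum_(j <- us) b j * j ^+ k).
  rewrite -sumrB mulr_sumr; apply: eq_big_seq => j jus.
  by rewrite -mulrA ifN ?mulrBl //; apply: contraNneq nuus => <-.
rewrite invfM; set A := (\prod_(j <- us) (y - j))^-1; set B := (\prod_(j <- us) (u - j))^-1.
by field.
Qed.

(** The divided difference is the complete homogeneous polynomial of degree [k - size us] in the
    nodes, with ['C(k, size us)] monomials; the Leibniz recursion matches Pascal's rule. As
    [1 <= M], the degree can be rounded up to [k]. *)
Lemma divdiff_bound (R : numDomainType) (M : R) us y k : 1 <= M ->
  (forall u, u \in y :: us -> `|u| <= M) ->
  `|divdiff (y :: us) k| <= 'C(k, size us)%:R * M ^+ k.
Proof.
move=> M1; elim: k y us => [|k IH] y us Mus.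
  by rewrite mulr1 bin0n size_eq0 /=; case: eqP => _; rewrite ?normr1 ?normr0.
have M0 : 0 <= M by apply: le_trans M1.
rewrite divdiffS; apply: le_trans (ler_normD _ _) _; rewrite normrM.
have yM : `|y| <= M by apply: Mus; rewrite mem_head.
have H1 : `|y| * `|divdiff (y :: us) k| <= 'C(k, size us)%:R * M ^+ k.+1.
  by rewrite exprS mulrCA ler_pM // IH.
case: us Mus H1 => [|u us] Mus H1; first by rewrite divdiff0 normr0 addr0 !bin0 in H1 *.
rewrite /= binS natrD mulrDl lerD //.
apply: le_trans (IH u us _) _; first by move=> w wus; apply: Mus; rewrite inE wus orbT.
by rewrite ler_wpM2l // exprS ler_peMl // exprn_ge0.
Qed.

(** * Sums of squared binomial coefficients *)

Lemma bernoulli_nat k n : (k ^ n.+1 + n.+1 * k ^ n <= k.+1 ^ n.+1)%N.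
Proof.
elim: n => [|n IH]; first by rewrite !expn1 expn0 addn1.
rewrite [(_.+1 ^ _)%N]expnS; apply: leq_trans (leq_mul (leqnn k.+1) IH).
rewrite !expnS; nia.
Qed.

(** Since ['C(k, e)] times e factorial is at most [k ^ e], this bounds [3 ^ e * 'C(k, e) ^ 2] by
    [(2 * e).+1 * k ^ (2 * e)], an increment controlled by [bernoulli_nat]. The 3 is the source of
    the square root of 3 in each edge factor. *)
Lemma expn3_fact e : (3 ^ e <= (2 * e).+1 * e`! ^ 2)%N.
Proof.
elim: e => // e IH; rewrite expnS factS.
apply: leq_trans (leq_mul (leqnn 3) IH) _.
rewrite expnMn mulnA [X in (_ <= X)%N]mulnA leq_mul2r; apply/orP; right; nia.
Qed.

(* Both sides are 0 at r = 0 and the increments compare termwise. *)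
Lemma sum_bin_sqr r e :
  (3 ^ e * (\sum_(k < r) 'C(k, e) ^ 2) <= r * (r ^ 2) ^ e)%N.
Proof.
rewrite -expnM -expnS; elim: r => [|k IH]; first by rewrite big_ord0 muln0.
rewrite big_ord_recr mulnDr; apply: leq_trans (bernoulli_nat k (2 * e)).
apply: leq_add => //; apply: leq_trans (leq_mul (expn3_fact e) (leqnn _)) _.
rewrite -mulnA -expnMn leq_mul2l; apply/orP; right.
rewrite [(2 * e)%N]mulnC expnM leq_exp2r //.
rewrite mulnC bin_ffact ffact_prod.
rewrite -[X in (_ <= _ ^ X)%N]card_ord -prod_nat_const.
by apply: leq_prod => i _; rewrite leq_subr.
Qed.

(** * The Vandermonde bound for one oriented graph *)

Section Graph.
Variables (C : numClosedFieldType) (r : nat) (v M : 'I_r -> C).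
Variable (N : 'I_r -> {set 'I_r}).
Hypotheses (vI : injective v) (M1 : forall i, 1 <= M i).
Hypothesis (vM : forall i, `|v i| <= M i).
Hypothesis (NL : forall i j, i \in N j -> (i < j)%N).
Hypothesis (NM : forall i j, i \in N j -> `|v i| <= M j).

Let nodes j : seq C := v j :: [seq v i | i <- enum (N j)].

Lemma nodes_uniq j : uniq (nodes j).
Proof.
rewrite /= map_inj_uniq // enum_uniq andbT; apply/mapP => -[i].
by rewrite mem_enum => /NL + /vI ij; rewrite ij ltnn.
Qed.

(** By [NM] the whole row is controlled by [M j] alone; its powers are raised to the last column
    index [r.-1], which leaves a sum of squared binomials. *)
Lemma nodes_norm j :
  \sum_(k < r) `|divdiff (nodes j) k| ^+ 2
  <= M j ^+ (2 * r.-1) * r%:R * (r%:R ^+ 2 / 3) ^+ #|N j|.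
Proof.
have Mj0 : 0 <= M j by apply: le_trans (M1 j).
have bnd : \sum_(k < r) `|divdiff (nodes j) k| ^+ 2 <=
   M j ^+ (2 * r.-1) * (\sum_(k < r) 'C(k, #|N j|) ^ 2)%:R.
  rewrite natr_sum mulr_sumr; apply: ler_sum => k _.
  rewrite natrX mulnC exprM -exprMn ler_pXn2r ?nnegrE ?normr_ge0 ?mulr_ge0 ?exprn_ge0 //.
  apply: le_trans (divdiff_bound k (M1 j) _) _.
    move=> u; rewrite inE => /orP[/eqP->//|/mapP[i]].
    by rewrite mem_enum => /NM ? ->.
  rewrite size_map -cardE mulrC ler_wpM2r // ler_weXn2l //.
  by rewrite -ltnS prednK ?(leq_trans _ (ltn_ord k)).
apply: le_trans bnd _; rewrite -mulrA ler_wpM2l ?exprn_ge0 //.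
rewrite exprMn exprVn mulrA ler_pdivlMr ?exprn_gt0 // mulrC -!natrX -!natrM ler_nat.
exact: sum_bin_sqr.
Qed.

(* Replacing row j of the Vandermonde matrix by divided differences at v j and
   its neighbours is a triangular change of rows whose j-th diagonal entry is
   the inverse of the product of the edges at j, so it divides the determinant
   by the product of all edges; Hadamard then bounds the new determinant. *)
Lemma graph_bound :
  (\prod_(i < r) \prod_(j < r | (i < j)%N) `|v j - v i|) ^+ 2 <=
  (\prod_j \prod_(i in N j) `|v j - v i|) ^+ 2 *
  ((\prod_j M j) ^+ (2 * r.-1) * r%:R ^+ r * (r%:R ^+ 2 / 3) ^+ (\sum_j #|N j|)).
Proof.
have := fun j => divdiff_interp (nodes_uniq j).
move=> /fin_all_exists[c cE].
pose V := (Vandermonde r (\row_j v j))^T.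
pose T : 'M[C]_r := \matrix_(j, i)
  (if i == j then (\prod_(u <- [seq v i | i <- enum (N j)]) (v j - u))^-1
   else if i \in N j then c j (v i) else 0).
pose W : 'M[C]_r := \matrix_(j, k) divdiff (nodes j) k.
pose E := \prod_j \prod_(i in N j) (v j - v i).
have E0 : E != 0.
  apply/prodf_neq0 => j _; apply/prodf_neq0 => i /NL ij.
  by rewrite subr_eq0; apply/eqP => /vI ji; rewrite ji ltnn in ij.
have WE : W = T *m V.
  apply/matrixP => j k; rewrite !mxE cE (bigD1 j) //= !mxE eqxx; congr (_ + _).
  rewrite big_map big_enum /= big_mkcond [RHS]big_mkcond; apply: eq_bigr => i _ /=.
  rewrite !mxE; case: eqP => [->|_] /=; first by case: ifP => // /NL; rewrite ltnn.
  by case: ifP => //; rewrite mul0r.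
have detT : \det T = E^-1.
  rewrite det_trig; last first.
    apply/is_trig_mxP => i j ij; rewrite mxE ifN ?ifN //.
      by apply/negP => /NL; rewrite ltnNge ltnW.
    by rewrite neq_ltn ij orbT.
  rewrite -prodfV; apply: eq_bigr => j _.
  by rewrite mxE eqxx big_map big_enum.
have detV : \det V = E * \det W by rewrite WE det_mulmx detT mulVKf.
have normV : `|\det V| = \prod_(i < r) \prod_(j < r | (i < j)%N) `|v j - v i|.
  rewrite det_tr det_Vandermonde normr_prod; apply: eq_bigr => i _.
  by rewrite normr_prod; apply: eq_bigr => j _; rewrite !mxE.
have normE : `|E| = \prod_j \prod_(i in N j) `|v j - v i|.
  by rewrite normr_prod; apply: eq_bigr => j _; rewrite normr_prod.
rewrite -normV -normE detV normrM exprMn ler_wpM2l ?exprn_ge0 //.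
apply: le_trans (hadamard W) _.
rewrite -prodrXl expr_sum -[r in X in _ * X * _]card_ord.
rewrite -prodr_const -!big_split /=; apply: ler_prod => j _.
rewrite sumr_ge0 /=; last by move=> k _; rewrite exprn_ge0.
by under eq_bigr do rewrite mxE; rewrite card_ord; apply: nodes_norm.
Qed.
End Graph.

(** * Subdiscriminant and multiplicities *)

Lemma prod_offdiag (R : comPzRingType) n (A : {set 'I_n}) (F : 'I_n -> 'I_n -> R) :
  (forall i j, F i j = F j i) ->
  \prod_(i in A) \prod_(j in A | (i < j)%N) F i j ^+ 2 =
  \prod_(i in A) \prod_(j in A | j != i) F j i.
Proof.
move=> Fsym.
(* The ordered pairs are cut along the diagonal; by symmetry each half contributes one factor of the
   square. *)
rewrite [RHS](eq_bigr (fun i : 'I_n => (\prod_(j in A | (i < j)%N) F i j) *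
   \prod_(j in A | (j < i)%N) F j i)); last first.
  move=> i _; rewrite (bigID (fun j : 'I_n => (i < j)%N)) /=; congr (_ * _).
    rewrite (eq_bigr (F i)) //; apply: eq_bigl => j.
    by rewrite -andbA; congr (_ && _); rewrite neq_ltn; case: ltngtP.
  by apply: eq_bigl => j; rewrite -andbA; congr (_ && _); rewrite neq_ltn; case: ltngtP.
rewrite big_split /= [X in _ * X](exchange_big_dep (mem A)) /=; last by move=> i j _ /andP[].
rewrite -big_split; apply: eq_bigr => i iA; rewrite prodrXl expr2; congr (_ * _).
by apply: eq_bigl => j; rewrite iA.
Qed.

Section Multiplicities.
Variables (C : numClosedFieldType) (xs : seq C).
Let s := undup xs.
Let d := size xs.
Let r := size s.

Lemma prod_offdiag_seq (t : seq C) : uniq t ->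
  (\prod_(i < size t) \prod_(j < size t | (i < j)%N) `|t`_j - t`_i|) ^+ 2
  = \prod_(y <- t) \prod_(z <- t | z != y) `|z - y|.
Proof.
move=> Ut.
transitivity (\prod_(i in [set: 'I_(size t)]) \prod_(j in [set: 'I_(size t)] | (i < j)%N)
   `|t`_j - t`_i| ^+ 2).
  rewrite -prodrXl; apply: eq_big => [i|i _]; first by rewrite inE.
  by rewrite -prodrXl; apply: eq_bigl => j; rewrite inE.
rewrite (prod_offdiag [set: 'I_(size t)] (F := fun i j => `|t`_j - t`_i|));
  last by move=> i j; rewrite distrC.
rewrite (big_nth 0) big_mkord; apply: eq_big => [i|i _]; first by rewrite inE.
rewrite (big_nth 0) big_mkord; apply: eq_big => [j|j _]; last by rewrite distrC.
by rewrite inE nth_uniq.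
Qed.

(* Only the index sets selecting each distinct root exactly once contribute to
   the subdiscriminant. *)
Let vals (I : {set 'I_d}) := [seq xs`_(val i) | i <- enum I].

Lemma vals_perm (I : {set 'I_d}) : #|I| = r -> uniq (vals I) -> perm_eq (vals I) s.
Proof.
move=> cI UI; apply: uniq_perm; rewrite ?undup_uniq //.
suff sub : {subset vals I <= s}.
  have [|_ eqi] := uniq_min_size UI sub; last exact: eqi.
  by rewrite size_map -cardE cI.
by move=> x /mapP[i _ ->]; rewrite mem_undup; apply/mem_nth/ltn_ord.
Qed.

Lemma prod_vals (I : {set 'I_d}) : #|I| = r ->
  \prod_(i in I) \prod_(j in I | (i < j)%N) `|xs`_i - xs`_j| ^+ 2 =
  if uniq (vals I) then \prod_(y <- s) \prod_(z <- s | z != y) `|z - y| else 0.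
Proof.
move=> cI; rewrite (prod_offdiag I (F := fun i j => `|xs`_i - xs`_j|));
  last by move=> i j; rewrite distrC.
have [UI|] := boolP (uniq _); last first.
  move=> /dinjectivePn[i iI [j /andP[ji jI] xij]].
  apply/eqP/prodf_eq0; exists i => //; apply/prodf_eq0; exists j.
    by rewrite jI.
  by rewrite xij subrr normr0.
have pI := vals_perm cI UI; have inj := elimT (dinjectiveP _ _) UI.
under [RHS]eq_bigr do rewrite -(perm_big _ pI).
rewrite -(perm_big _ pI) /= big_map big_enum; apply: eq_bigr => i iI.
rewrite big_map big_enum_cond; apply: eq_bigl => j.
have [jI|] //= := boolP (j \in I); congr negb.
by apply/eqP/eqP => [->//|/inj]; apply.
Qed.

Lemma card_nth_eq y : #|[pred i : 'I_d | xs`_i == y]| = count_mem y xs.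
Proof. by rewrite -sum1_card -sum1_count (big_nth 0) big_mkord. Qed.

(** Each such [I] is the image of a function choosing, for every distinct root, an index where it
    occurs; [family F] counts these functions. *)
Lemma card_transversals :
  (#|[set I : {set 'I_d} | (#|I| == r) && uniq (vals I)]|
    <= \prod_(y <- s) count_mem y xs)%N.
Proof.
pose F (j : 'I_r) : pred 'I_d := [pred i : 'I_d | xs`_i == s`_j].
have cF : #|family F| = (\prod_(y <- s) count_mem y xs)%N.
  rewrite card_family foldrE big_map big_enum /= (big_nth 0) big_mkord.
  by apply: eq_bigr => j _; rewrite card_nth_eq.
rewrite -cF -[X in (_ <= X)%N]cardsE.
apply: leq_trans (leq_imset_card (fun g : {ffun 'I_r -> 'I_d} => g @: setT) _).
apply/subset_leq_card/subsetP => I; rewrite inE => /andP[/eqP cI UI].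
have /fin_all_exists2[g gI gF] : forall j : 'I_r, exists2 i : 'I_d, i \in I & xs`_i == s`_j.
  move=> j; have : s`_j \in vals I by rewrite (perm_mem (vals_perm cI UI)) mem_nth.
  by move=> /mapP[i]; rewrite mem_enum => iI ->; exists i.
apply/imsetP; exists (finfun g).
  by rewrite inE; apply/familyP => j; rewrite ffunE; apply: gF.
apply/esym/eqP; rewrite eqEcard; apply/andP; split.
  by apply/subsetP => _ /imsetP[j _ ->]; rewrite ffunE.
rewrite card_imset ?cardsT ?card_ord ?cI // => i j; rewrite !ffunE => gij.
apply/val_inj/eqP; rewrite /= -(nth_uniq 0 (ltn_ord i) (ltn_ord j) (undup_uniq xs)).
by rewrite -(eqP (gF i)) gij; apply: gF.
Qed.

Lemma sum_multiplicities : (\sum_(y <- s) count_mem y xs = d)%N.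
Proof.
rewrite -[RHS](perm_size (perm_count_undup xs)) size_flatten sumnE !big_map.
by apply: eq_bigr => y _; rewrite size_nseq.
Qed.

Lemma prod_multiplicities :
  ((\prod_(y <- s) count_mem y xs) ^ 3 <= 3 ^ minn d (2 * d - 2 * r))%N.
Proof.
have expnprod (h : C -> nat) : (3 ^ (\sum_(y <- s) h y) = \prod_(y <- s) 3 ^ h y)%N.
  by elim/big_rec2: _ => // y a b _ <-; rewrite expnD.
have prodexp : ((\prod_(y <- s) count_mem y xs) ^ 3 = \prod_(y <- s) (count_mem y xs) ^ 3)%N.
  by elim/big_rec2: _ => // y a b _ <-; rewrite expnMn.
(* Equality occurs at 3; beyond that, passing to the next integer multiplies the cube by less than
   3. *)
have cube3 m : (m.+1 ^ 3 <= 3 ^ m.+1)%N.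
  elim: m => // -[|[|m]] // IH; rewrite [(3 ^ _)%N]expnS.
  by apply: leq_trans (leq_mul (leqnn 3) IH); nia.
have cube9 m : (m.+1 ^ 3 <= 3 ^ (2 * m))%N.
  elim: m => // -[|m] // IH; rewrite mulnS expnD.
  by apply: leq_trans (leq_mul (leqnn _) IH); nia.
have sum2 : (\sum_(y <- s) 2 * (count_mem y xs).-1 = 2 * d - 2 * r)%N.
  rewrite -big_distrr /= -mulnBr; congr (_ * _)%N; apply/eqP.
  rewrite -(eqn_add2r r) subnK ?size_undup //.
  rewrite -sum_multiplicities /r -sum1_size -big_split; apply/eqP/eq_big_seq => y.
  by rewrite /s mem_undup -has_pred1 has_count /=; lia.
rewrite /minn; case: ifP => _; rewrite prodexp.
  rewrite -[X in (_ <= _ ^ X)%N]sum_multiplicities expnprod.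
  by apply: leq_prod => y _; case: (count_mem y xs).
rewrite -sum2 expnprod big_seq [X in (_ <= X)%N]big_seq; apply: leq_prod => y.
by rewrite /s mem_undup -has_pred1 has_count; case: (count_mem y xs).
Qed.

Lemma prod_undup_le (g : C -> C) : (forall x, 1 <= g x) ->
  \prod_(y <- s) g y <= \prod_(x <- xs) g x.
Proof.
move=> g1; rewrite /s; elim: xs => [|x t IH] /=; first exact: lexx.
have g0 z : 0 <= g z by apply: le_trans (g1 z).
have p0 (u : seq C) : 0 <= \prod_(x <- u) g x by apply: prodr_ge0.
rewrite [X in _ <= X]big_cons; case: ifP => _.
  by apply: le_trans IH _; rewrite ler_peMl.
by rewrite big_cons ler_wpM2l.
Qed.

(** After the triangle inequality, the nonzero terms all have the same norm, and [card_transversals]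
    bounds their number. *)
Lemma norm_sDisc (p : {poly C}) : p != 0 ->
  p = lead_coef p *: \prod_(x <- xs) ('X - x%:P) ->
  `|sDisc p xs ((size p).-1 - r)| <=
  `|lead_coef p| ^+ (2 * r - 2) * (\prod_(y <- s) count_mem y xs)%:R *
   \prod_(y <- s) \prod_(z <- s | z != y) `|z - y|.
Proof.
move=> p0 pE; have sp : (size p).-1 = d.
  by rewrite pE size_scale ?lead_coef_eq0 // size_prod_XsubC.
rewrite /sDisc sp subKn ?size_undup // normrM normrX -mulrA ler_wpM2l ?exprn_ge0 //.
apply: le_trans (ler_norm_sum _ _ _) _.
rewrite (eq_bigr (fun I : {set 'I_d} => if uniq (vals I) then
  \prod_(y <- s) \prod_(z <- s | z != y) `|z - y| else 0)); last first.
  move=> I /eqP cI; rewrite -prod_vals // normr_prod; apply: eq_bigr => i _.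
  by rewrite normr_prod; apply: eq_bigr => j _; rewrite normrX.
rewrite -big_mkcondr /= sumr_const -[X in X <= _]mulr_natl ler_wpM2r //.
  by apply: prodr_ge0 => y _; apply: prodr_ge0.
rewrite ler_nat; apply: leq_trans card_transversals.
by apply/subset_leq_card/subsetP => I; rewrite inE.
Qed.

End Multiplicities.

(** * The separation as an attained distance *)

Lemma foldr_min_mem d (T : porderType d) (x : T) t :
  foldr Order.min x t \in x :: t.
Proof.
elim: t => [|y t IH] /=; first exact: mem_head.
(* Even in a partial order, [Order.min] returns one of its arguments. *)
rewrite minElt; case: ifP => _; first by rewrite !inE eqxx orbT.
by move: IH; rewrite !inE => /orP[->//|->]; rewrite !orbT.
Qed.

(** Of two distinct roots at least one differs from [v], so the list of distances is nonempty and
    the default 0 of [head] is never reached. *)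
Lemma sep_attained (C : numClosedFieldType) (xs : seq C) v :
  (2 <= size (undup xs))%N ->
  exists2 w, w \in xs & (w != v) && (sep xs v == `|v - w|).
Proof.
move=> r2; rewrite /sep; set ds := map _ _.
have : ds != [::].
  rewrite -size_eq0 size_map size_filter -lt0n -has_count.
  have := undup_uniq xs; case: (undup xs) r2 => [|x [|y t]] //= _.
  rewrite inE negb_or => /andP[/andP[xy _] _].
  by case: (eqVneq x v) => [<-|//]; rewrite eq_sym xy.
case E : ds => [|x t] // _.
have : foldr Num.min (head 0 (x :: t)) (x :: t) \in ds.
  by have := foldr_min_mem x (x :: t); rewrite E inE => /orP[/eqP->|//]; exact: mem_head.
move=> /mapP[w]; rewrite mem_filter mem_undup => /andP[wv wx] ->.
by exists w; rewrite ?wv /=.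
Qed.

(** * Splitting the nearest-root edges *)

Section Split.
Variables (R : Type) (idx : R) (op : Monoid.com_law idx) (r : nat).
Variables (A : {set 'I_r}) (f : 'I_r -> 'I_r) (F : 'I_r -> 'I_r -> R).
Hypotheses (fN : forall i, f i != i) (Fsym : forall i j, F i j = F j i).

(* The directed edges i -> f i may contain two-cycles; separating those with
   f i < i from those with i < f i yields two simple graphs, each oriented
   towards the larger index. *)
Definition lower_edges (j : 'I_r) := [set i | [&& j \in A, i == f j & (i < j)%N]].
Definition upper_edges (j : 'I_r) := [set i in A | (f i == j) && (i < j)%N].

(** The operation is kept general to serve twice: multiplication for the edge lengths, addition for
    the number of edges. *)
Lemma big_split_edges :
  \big[op/idx]_(i in A) F i (f i) =
  op (\big[op/idx]_j \big[op/idx]_(i in lower_edges j) F j i)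
     (\big[op/idx]_j \big[op/idx]_(i in upper_edges j) F j i).
Proof.
rewrite (bigID (fun i => f i < i)%N) /=; congr (op _ _).
  rewrite big_mkcond; apply: eq_bigr => j _; case: ifP => [/andP[jA fj]|nj].
    rewrite (_ : lower_edges j = [set f j]) ?big_set1 //.
    by apply/setP => i; rewrite !inE jA /=; case: eqP => // ->.
  rewrite big_pred0 // => i; rewrite inE; apply: contraFF nj => /and3P[-> /eqP<-] //.
rewrite (partition_big f predT) //=; apply: eq_bigr => j _.
apply: eq_big => [i|i /andP[_ /eqP<-]]; last exact: Fsym.
rewrite inE -andbA; congr (_ && _); case: eqP => [<-|]; rewrite ?andbF //= andbT.
by rewrite -leqNgt leq_eqVlt val_eqE eq_sym (negPf (fN i)).
Qed.
End Split.

(** * Combining the two graph bounds *)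

Lemma max1_ge (C : numClosedFieldType) (x y : C) :
  `|x| <= `|y| -> `|x| <= Num.max 1 `|y|.
Proof.
move=> xy; rewrite comparable_le_max ?xy ?orbT //.
by rewrite real_comparable ?realE ?ler01 ?normr_ge0.
Qed.

Lemma max1_ge1 (C : numClosedFieldType) (y : C) : 1 <= Num.max 1 `|y|.
Proof.
rewrite comparable_le_max ?lexx //.
by rewrite real_comparable ?realE ?ler01 ?normr_ge0.
Qed.

Lemma sep_bound (C : numClosedFieldType) (xs V' : seq C) :
  (2 <= size (undup xs))%N -> uniq V' -> {subset V' <= xs} ->
  let s := undup xs in
  let r := size s in
  \prod_(y <- s) \prod_(z <- s | z != y) `|z - y| <=
  \prod_(v <- V') sep xs v *
  ((\prod_(y <- s) Num.max 1 `|y|) ^+ (2 * r.-1) * r%:R ^+ r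
   * (r%:R / sqrtC 3) ^+ size V').
Proof.
move=> r2 UV sV; set s := undup xs; set r := size s; cbv zeta.
pose t := sort (fun x y : C => `|x| <= `|y|) s.
have pt : perm_eq t s by rewrite perm_sort.
have st : size t = r by rewrite size_sort.
have Ut : uniq t by rewrite sort_uniq undup_uniq.
pose v (i : 'I_r) : C := t`_i.
have vI : injective v.
  move=> i j /eqP; rewrite /v nth_uniq ?st // => /eqP; exact: val_inj.
have v_mono (i j : 'I_r) : (i <= j)%N -> `|v i| <= `|v j|.
  apply: (@sorted_leq_nth _ (fun x y : C => `|x| <= `|y|)); rewrite ?inE ?st //.
  - by move=> x y z; apply: le_trans.
  - by apply: sort_sorted => x y; apply: real_leVge; rewrite normr_real.
have /fin_all_exists2[f fN fsep] : forall i : 'I_r,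
    exists2 j : 'I_r, j != i & sep xs (v i) = `|v i - v j|.
  move=> i; have [w wxs /andP[wv /eqP ->]] := sep_attained (v i) r2.
  have wt : w \in t by rewrite (perm_mem pt) mem_undup.
  have wr : (index w t < r)%N by rewrite -st index_mem.
  exists (Ordinal wr); last by rewrite /v nth_index.
  by apply: contraNneq wv => <-; rewrite /v nth_index.
pose A := [set i | v i \in V'].
have pA : perm_eq [seq v i | i <- enum A] V'.
  apply: uniq_perm => //; first by rewrite map_inj_uniq ?enum_uniq.
  move=> x; apply/mapP/idP => [[i]|xV]; first by rewrite mem_enum inE => iA ->.
  have xt : x \in t by rewrite (perm_mem pt) mem_undup sV.
  have xr : (index x t < r)%N by rewrite -st index_mem.
  by exists (Ordinal xr); rewrite ?mem_enum ?inE /v /= nth_index.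
pose F (i j : 'I_r) : C := `|v i - v j|.
have Fsym i j : F i j = F j i by rewrite /F distrC.
pose M (i : 'I_r) := Num.max 1 `|v i|.
have M1 i : 1 <= M i by apply: max1_ge1.
have vM i : `|v i| <= M i by apply: max1_ge.
(* Sorting by modulus turns the orientation [i < j] of an edge into the norm condition [NM]. *)
have bnd (N : 'I_r -> {set 'I_r}) (NL : forall i j, i \in N j -> (i < j)%N) :=
  graph_bound vI M1 vM NL (fun i j ij => max1_ge (v_mono i j (ltnW (NL i j ij)))).
have /bnd B1 : forall i j, i \in lower_edges A f j -> (i < j)%N.
  by move=> i j; rewrite inE => /and3P[].
have /bnd B2 : forall i j, i \in upper_edges A f j -> (i < j)%N.
  by move=> i j; rewrite inE => /and3P[].
have perm_ord (g : C -> C) : \prod_(y <- s) g y = \prod_(i < r) g (v i).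
  by rewrite -(perm_big _ pt) (big_nth 0) big_mkord st.
have DE : \prod_(y <- s) \prod_(z <- s | z != y) `|z - y| =
    (\prod_(i < r) \prod_(j < r | (i < j)%N) `|v j - v i|) ^+ 2.
  under eq_bigr do rewrite -(perm_big _ pt).
  by rewrite -(perm_big _ pt) -(prod_offdiag_seq Ut) st.
have cardE : size V' =
    (\sum_j #|lower_edges A f j| + \sum_j #|upper_edges A f j|)%N.
  rewrite -(perm_size pA) size_map -cardE -sum1_card.
  rewrite (big_split_edges _ A fN (F := fun _ _ => 1%N)) //=.
  by congr (_ + _)%N; apply: eq_bigr => j _; rewrite sum1_card.
have sepE : \prod_(v <- V') sep xs v =
    (\prod_j \prod_(i in lower_edges A f j) `|v j - v i|) *
    (\prod_j \prod_(i in upper_edges A f j) `|v j - v i|).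
  rewrite -(big_split_edges *%R A fN Fsym) -(perm_big _ pA) big_map big_enum.
  by apply: eq_bigr => i _; apply: fsep.
rewrite DE perm_ord sepE cardE; move: B1 B2.
have := erefl (r%:R / sqrtC 3 : C); set q := {2}(_ / _) => qE.
have -> : r%:R ^+ 2 / 3 = q ^+ 2 :> C by rewrite -qE exprMn exprVn sqrtCK.
have q0 : 0 <= q by rewrite -qE divr_ge0 // sqrtC_ge0.
set D := _ ^+ 2; set K := _ * _%:R ^+ r; set X1 := \prod_j _; set X2 := \prod_j _.
move=> B1 B2.
have D0 : 0 <= D.
  by apply/exprn_ge0/prodr_ge0 => i _; apply: prodr_ge0.
have X10 : 0 <= X1 by apply: prodr_ge0 => i _; apply: prodr_ge0.
have X20 : 0 <= X2 by apply: prodr_ge0 => i _; apply: prodr_ge0.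
have K0 : 0 <= K.
  by rewrite mulr_ge0 ?exprn_ge0 ?prodr_ge0 // => i _; apply: le_trans (M1 i).
clearbody D K X1 X2.
(* [B1] and [B2] both bound [D], so their product bounds [D ^+ 2]; the claim is its square root. *)
rewrite -(@ler_pXn2r _ 2) ?nnegrE ?mulr_ge0 ?exprn_ge0 //.
rewrite [D ^+ 2]expr2; apply: le_trans (ler_pM D0 D0 B1 B2) _.
by rewrite -!exprM ![(2 * _)%N]mulnC !exprM exprD le_eqVlt; apply/orP; left; apply/eqP; ring.
Qed.

Theorem theorem9 (C : numClosedFieldType) (p : {poly C}) (xs : seq C)
  (V' : seq C)
  (hp0 : p != 0)
  (hfact : p = lead_coef p *: \prod_(x <- xs) ('X - x%:P))
  (hr : (2 <= size (undup xs))%N)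
  (huniq : uniq V') (hsub : {subset V' <= xs}) :
  let d := (size p).-1 in
  let r := size (undup xs) in
  `|sDisc p xs (d - r)| * mahler p xs ^- (2 * (r - 1))
    * (r%:R / sqrtC 3) ^- size V' * r%:R ^- r
    * (3.-root (3^-1)) ^+ minn d (2 * d - 2 * r)
  <= \prod_(v <- V') sep xs v.
Proof.
have dE : (size p).-1 = size xs.
  by rewrite hfact size_scale ?lead_coef_eq0 // size_prod_XsubC.
set d := (size p).-1; set r := size (undup xs); cbv zeta.
have := norm_sDisc hp0 hfact; have := sep_bound hr huniq hsub.
have := prod_multiplicities xs; have := prod_undup_le xs (@max1_ge1 C).
rewrite /mahler -dE -/r -/d subn1.
set m := \prod_(y <- _) count_mem _ _; set e := minn _ _.
set P := \prod_(y <- undup xs) Num.max _ _; set Q := \prod_(x <- xs) Num.max _ _.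
set D := \prod_(y <- _) _; set S := \prod_(v <- _) _; set s := `|_| => PQ m3 DS sD.
set a := `|lead_coef p| in sD *.
set q := r%:R / sqrtC 3 in DS *.
have a0 : 0 < a by rewrite normr_gt0 lead_coef_eq0.
have P0 : 0 < P by apply: prodr_gt0 => y _; apply: lt_le_trans (max1_ge1 y).
have Q0 : 0 < Q by apply: lt_le_trans PQ.
have r0 : 0 < r%:R :> C by rewrite ltr0n ltnW.
have q0 : 0 < q by rewrite divr_gt0 // sqrtC_gt0.
set k := (2 * r.-1)%N in DS *.
have kE : (2 * r - 2)%N = k by rewrite /k; lia.
rewrite kE in sD.
set t := 3.-root _.
have t0 : 0 <= t by rewrite rootC_ge0 // invr_ge0.
have D0 : 0 <= D by apply: prodr_ge0 => y _; apply: prodr_ge0.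
(* Cubing removes the cube root and leaves [prod_multiplicities]. *)
have mt : m%:R * t ^+ e <= 1.
  rewrite -(@expr_le1 _ 3) ?mulr_ge0 ?exprn_ge0 // exprMn -exprM mulnC exprM rootCK //.
  by rewrite exprVn ler_pdivrMr ?exprn_gt0 // mul1r -!natrX ler_nat.
(* The powers of the leading coefficient cancel, and [P <= Q] compares distinct roots with roots
   counted with multiplicity. *)
have le1 : a ^+ k * (a * Q) ^- k * P ^+ k <= 1.
  rewrite exprMn invfM mulrA divff ?expf_neq0 ?gt_eqF // mul1r mulrC.
  by rewrite ler_pdivrMr ?exprn_gt0 // mul1r; apply: lerXn2r; rewrite ?nnegrE // ltW.
have qn0 : 0 < q ^+ size V' by apply: exprn_gt0.
have rr0 : 0 < r%:R ^+ r :> C by apply: exprn_gt0.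
have aQ0 : 0 < (a * Q) ^+ k by rewrite exprn_gt0 ?mulr_gt0.
have Pk0 : 0 < P ^+ k by apply: exprn_gt0.
have te0 : 0 <= t ^+ e by apply: exprn_ge0.
have ak0 : 0 < a ^+ k by apply: exprn_gt0.
have step : s * t ^+ e * (a * Q) ^- k * P ^+ k <= D.
  apply: (@le_trans _ _ ((a ^+ k * m%:R * D) * t ^+ e * (a * Q) ^- k * P ^+ k)).
    by rewrite !ler_wpM2r // ?invr_ge0 ltW.
  rewrite (_ : _ * P ^+ k = (m%:R * t ^+ e) * (a ^+ k * (a * Q) ^- k * P ^+ k) * D);
    last by ring.
  rewrite ler_piMl // mulr_ile1 ?mulr_ge0 ?ler0n //;
    by rewrite ?invr_ge0 ltW.
(* Multiplying by these positive factors turns the right side into the bound [DS] and the left side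
   into that of [step]. *)
rewrite -(ler_pM2r Pk0) -(ler_pM2r rr0) -(ler_pM2r qn0).
rewrite (_ : _ * q ^+ _ = s * t ^+ e * (a * Q) ^- k * P ^+ k); last first.
  move: (q ^+ _) (r%:R ^+ r) ((a * Q) ^- k) qn0 rr0 => A B w A0 B0.
  by field; rewrite !gt_eqF.
apply: le_trans step _; apply: le_trans DS _.
by rewrite le_eqVlt !mulrA eqxx.
Qed.
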